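(* Consider the rational matrix $$R(s)=A_0+sA_1+s^2A_2+\sum_{j=1}^mA_{-j}\,r_j(s)\in\mathbb{C}^{n\times n},\qquad r_j(s)=\alpha_j+a_j^T\Phi(s),$$ where the vector of rational basis functions $\Phi$ is the same for all $r_j$ (see the context). The system $$R(s)\hat x=\hat b$$ is related to the linear system $$(\mathbf{A}-s\mathbf{E})\hat{\mathbf{x}}=e_1\otimes\hat b,$$ with $$\mathbf{L}(s)=\mathbf{A}-s\mathbf{E}=\begin{bmatrix}\tilde A_0+sA_1&sA_2&a_1^T\otimes A_{-1}+\cdots+a_m^T\otimes A_{-m}\\ sI&-I&0\\ (c_0+sc_1)\otimes I&0&(C_0+sC_1)\otimes I\end{bmatrix},$$ $$\tilde A_0=A_0+\alpha_1A_{-1}+\cdots+\alpha_mA_{-m},\qquad \hat{\mathbf{x}}=\mathbf{\Phi}(s)\otimes\hat x(s),\qquad \mathbf{\Phi}(s)=\begin{pmatrix}1\\ s\\ \Phi(s)\end{pmatrix}.$$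
   Context: $A_0,A_1,A_2,A_{-1},\dots,A_{-m}\in\mathbb{C}^{n\times n}$, $\hat b\in\mathbb{C}^n$, $\alpha_1,\dots,\alpha_m\in\mathbb{C}$, $a_1,\dots,a_m,c_0,c_1\in\mathbb{C}^{\tilde d}$ and $C_0,C_1\in\mathbb{C}^{\tilde d\times\tilde d}$ with $C_1$ nonsingular. The basis functions are $\Phi(s)=-(C_0+sC_1)^{-1}(c_0+sc_1)$. $\otimes$ denotes the Kronecker product, $I$ is the $n\times n$ identity matrix, and $e_1$ is the first unit vector of $\mathbb{C}^{\tilde d+2}$. The constant matrices $\mathbf{A}$ and $\mathbf{E}$, of size $(\tilde d+2)n$, are the coefficient matrices of the displayed pencil, which is linear in $s$. The vector $\hat x=\hat x(s)$ is the solution vector of $R(s)\hat x=\hat b$. *)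

(* Defs.v *)
(* The complex numbers are K[i] for K : realType. *)
From HB Require Import structures.
From mathcomp Require Import all_boot all_order all_algebra.
From mathcomp Require Import reals.
From mathcomp Require Import mxtens complex.

Set Implicit Arguments.
Unset Strict Implicit.
Unset Printing Implicit Defensive.

Import GRing.Theory.
Local Open Scope ring_scope.

Notation "A *t B" := (tensmx A B)
  (at level 40, left associativity, format "A  *t  B") : ring_scope.

(* Kronecker products with a row or a column: [*t] yields 1 * n rows
   (resp. columns), which [mul1n] identifies with n. *)
Definition kron_row (K : realType) (d n : nat) (u : 'rV[K[i]]_d)
    (B : 'M[K[i]]_n) : 'M[K[i]]_(n, d * n) :=
  castmx (mul1n n, erefl (d * n)%N) (u *t B).

Definition kron_col (K : realType) (d n : nat) (v : 'cV[K[i]]_d)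
    (B : 'M[K[i]]_n) : 'M[K[i]]_(d * n, n) :=
  castmx (erefl (d * n)%N, mul1n n) (v *t B).

(* [invmx] is the genuine inverse only when C0 + s C1 is nonsingular. *)
Definition basis_fun (K : realType) (d : nat) (c0 c1 : 'cV[K[i]]_d)
    (C0 C1 : 'M[K[i]]_d) (s : K[i]) : 'cV[K[i]]_d :=
  - (invmx (C0 + s *: C1) *m (c0 + s *: c1)).

Definition rat_coef (K : realType) (d : nat) (c0 c1 : 'cV[K[i]]_d)
    (C0 C1 : 'M[K[i]]_d) (alpha : K[i]) (a : 'cV[K[i]]_d) (s : K[i]) : K[i] :=
  alpha + (a^T *m basis_fun c0 c1 C0 C1 s) 0 0.

(* [Am j] and [alpha j], [a j] stand for A_{-(j+1)} and alpha_{j+1}, a_{j+1}. *)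
Definition rat_mx (K : realType) (n m d : nat) (A0 A1 A2 : 'M[K[i]]_n)
    (Am : 'I_m -> 'M[K[i]]_n) (alpha : 'I_m -> K[i]) (a : 'I_m -> 'cV[K[i]]_d)
    (c0 c1 : 'cV[K[i]]_d) (C0 C1 : 'M[K[i]]_d) (s : K[i]) : 'M[K[i]]_n :=
  A0 + s *: A1 + s ^+ 2 *: A2
  + \sum_(j < m) rat_coef c0 c1 C0 C1 (alpha j) (a j) s *: Am j.

Definition ext_basis (K : realType) (d : nat) (c0 c1 : 'cV[K[i]]_d)
    (C0 C1 : 'M[K[i]]_d) (s : K[i]) : 'cV[K[i]]_d.+2 :=
  col_mx (1%:M : 'cV_1) (col_mx (s%:M : 'cV_1) (basis_fun c0 c1 C0 C1 s)).

Definition first_unit (K : realType) (d : nat) : 'cV[K[i]]_d.+2 :=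
  delta_mx 0 0.

(* The dimension d.+2 * n is convertible to n + (n + d * n). *)
Definition block3_mx (K : realType) (n d : nat)
    (B11 B12 : 'M[K[i]]_n) (B13 : 'M[K[i]]_(n, d * n))
    (B21 B22 : 'M[K[i]]_n) (B23 : 'M[K[i]]_(n, d * n))
    (B31 B32 : 'M[K[i]]_(d * n, n)) (B33 : 'M[K[i]]_(d * n)) :
    'M[K[i]]_(d.+2 * n) :=
  (col_mx (row_mx B11 (row_mx B12 B13))
  (col_mx (row_mx B21 (row_mx B22 B23))
          (row_mx B31 (row_mx B32 B33)))
   : 'M[K[i]]_(n + (n + d * n))).

Definition A0_tilde (K : realType) (n m : nat) (A0 : 'M[K[i]]_n)
    (Am : 'I_m -> 'M[K[i]]_n) (alpha : 'I_m -> K[i]) : 'M[K[i]]_n :=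
  A0 + \sum_(j < m) alpha j *: Am j.

Definition pencil (K : realType) (n m d : nat) (A0 A1 A2 : 'M[K[i]]_n)
    (Am : 'I_m -> 'M[K[i]]_n) (alpha : 'I_m -> K[i]) (a : 'I_m -> 'cV[K[i]]_d)
    (c0 c1 : 'cV[K[i]]_d) (C0 C1 : 'M[K[i]]_d) (s : K[i]) :
    'M[K[i]]_(d.+2 * n) :=
  block3_mx
    (A0_tilde A0 Am alpha + s *: A1) (s *: A2)
      (\sum_(j < m) kron_row (a j)^T (Am j))
    s%:M (- 1%:M) 0
    (kron_col (c0 + s *: c1) 1%:M) 0 ((C0 + s *: C1) *t 1%:M).

(* The constant coefficient of the pencil. *)
Definition pencil_A (K : realType) (n m d : nat) (A0 : 'M[K[i]]_n)
    (Am : 'I_m -> 'M[K[i]]_n) (alpha : 'I_m -> K[i]) (a : 'I_m -> 'cV[K[i]]_d)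
    (c0 : 'cV[K[i]]_d) (C0 : 'M[K[i]]_d) : 'M[K[i]]_(d.+2 * n) :=
  block3_mx
    (A0_tilde A0 Am alpha) 0 (\sum_(j < m) kron_row (a j)^T (Am j))
    0 (- 1%:M) 0
    (kron_col c0 1%:M) 0 (C0 *t 1%:M).

(* The opposite of the coefficient of s in the pencil. *)
Definition pencil_E (K : realType) (n d : nat) (A1 A2 : 'M[K[i]]_n)
    (c1 : 'cV[K[i]]_d) (C1 : 'M[K[i]]_d) : 'M[K[i]]_(d.+2 * n) :=
  block3_mx
    (- A1) (- A2) 0
    (- 1%:M) 0 0
    (- kron_col c1 1%:M) 0 (- (C1 *t 1%:M)).

(* Main.v *)
Require Import Defs.
From HB Require Import structures.
From mathcomp Require Import all_boot all_order all_algebra.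
From mathcomp Require Import reals.
From mathcomp Require Import mxtens complex.

Set Implicit Arguments.
Unset Strict Implicit.
Unset Printing Implicit Defensive.

Import GRing.Theory.
Local Open Scope ring_scope.

(* Multiplying the pencil by Phi(s) (x) x kills the last two block rows and
   leaves R(s) x in the first one.  Conversely, since C0 + s C1 is nonsingular,
   the last two block rows force every solution of the pencil system to be
   Phi(s) (x) u, where u is its first block. *)

Section Kronecker.

Variable R : comNzRingType.

Lemma tensmxDl m n p q (A B : 'M[R]_(m, n)) (C : 'M[R]_(p, q)) :
  (A + B) *t C = A *t C + B *t C.
Proof. by apply/matrixP=> i j; rewrite !mxE mulrDl. Qed.

Lemma tensmxZl m n p q (k : R) (A : 'M[R]_(m, n)) (C : 'M[R]_(p, q)) :
  (k *: A) *t C = k *: (A *t C).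
Proof. by apply/matrixP=> i j; rewrite !mxE mulrA. Qed.

Lemma tensmxNl m n p q (A : 'M[R]_(m, n)) (C : 'M[R]_(p, q)) :
  (- A) *t C = - (A *t C).
Proof. by apply/matrixP=> i j; rewrite !mxE mulNr. Qed.

Lemma tens_mx11 m n : (1%:M : 'M[R]_m) *t (1%:M : 'M[R]_n) = 1%:M.
Proof.
apply/matrixP=> i j; rewrite !mxE -natrM mulnb.
(* [mxtens_unindex] is injective, so two product indices agree exactly when both of their components
   do. *)
by rewrite -(can_eq (@mxtens_unindexK m n)) -[RHS]/((_ == _)%:R) xpair_eqE.
Qed.

(** Peels a leading scalar entry off a Kronecker product; two uses turn a vector of size 1 + (1 + d)
    into three blocks. *)
Lemma tens_col_scalar k n (c : R) (v : 'cV[R]_k) (x : 'cV[R]_n) :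
  col_mx (c%:M : 'cV_1) v *t x = col_mx (c *: x) (v *t x) :> 'cV_(n + k * n).
Proof.
rewrite tens_col_mx tens_scalar_mx (castmx_col (mul1n n) erefl).
by rewrite castmx_comp !castmx_id; congr col_mx; rewrite castmx_id.
Qed.

(* Instance of [tensmx_mul] whose common width is 1 rather than [1 * 1]:
   the two are convertible, but [rewrite] does not identify them. *)
Lemma tensmx_mul_col m n p q (A : 'M[R]_(m, n)) (B : 'M[R]_(p, q))
    (c : 'cV[R]_n) (x : 'cV[R]_q) :
  (A *t B) *m (c *t x : 'cV_(n * q)) = (A *m c) *t (B *m x).
Proof. exact: (tensmx_mul A B c x). Qed.

End Kronecker.

Section Blocks.

Variables (K : realType) (n d : nat).
Implicit Types (u v x : 'cV[K[i]]_n) (w : 'cV[K[i]]_(d * n)).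

Lemma kron_col_mul (c : 'cV[K[i]]_d) (B : 'M[K[i]]_n) x :
  kron_col c B *m x = c *t (B *m x).
Proof.
(* The cast is moved onto [x], which then reads as the Kronecker product of the 1 by 1 identity with
   [x], so that the mixed-product rule applies. *)
have -> : kron_col c B *m x
    = (c *t B) *m castmx (esym (mul1n n), erefl) x.
  by rewrite mulmx_cast /kron_col esymK castmx_id.
have -> : castmx (esym (mul1n n), erefl) x = 1%:M *t x.
  by rewrite tens_scalar_mx scale1r; apply/matrixP=> i j; rewrite !castmxE; congr (x _ _); apply: val_inj.
by rewrite [LHS](tensmx_mul c B 1%:M x) mulmx1.
Qed.

(** By the mixed-product rule the left factor becomes the 1 by 1 matrix [u *m v], which acts as a
    scalar. With [v] = Phi(s) this scalar is the nonconstant part of r_j(s). *)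
Lemma kron_row_mul (u : 'rV[K[i]]_d) (B : 'M[K[i]]_n) (v : 'cV[K[i]]_d) x :
  kron_row u B *m (v *t x) = (u *m v) 0 0 *: (B *m x).
Proof.
have -> : kron_row u B *m (v *t x)
    = castmx (mul1n n, erefl) ((u *t B) *m (v *t x)).
  by rewrite castmx_mul castmx_id.
rewrite tensmx_mul [u *m v]mx11_scalar tens_scalar_mx castmx_comp castmx_id.
by rewrite !mxE.
Qed.

Lemma kron_colDZ (s : K[i]) (c c' : 'cV[K[i]]_d) (B : 'M[K[i]]_n) :
  kron_col (c + s *: c') B = kron_col c B + s *: kron_col c' B.
Proof.
by rewrite /kron_col tensmxDl tensmxZl; apply/matrixP=> i j; rewrite !(castmxE, mxE).
Qed.

Definition col3_mx u v w : 'cV[K[i]]_(d.+2 * n) :=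
  (col_mx u (col_mx v w) : 'cV_(n + (n + d * n))).

Lemma col3_mxP (xx : 'cV[K[i]]_(d.+2 * n)) :
  exists u v w, xx = col3_mx u v w.
Proof.
pose yy : 'cV_(n + (n + d * n)) := xx.
exists (usubmx yy), (usubmx (dsubmx yy)), (dsubmx (dsubmx yy)).
by rewrite /col3_mx !vsubmxK.
Qed.

Lemma col3_mx_inj u v w u' v' w' :
  col3_mx u v w = col3_mx u' v' w' -> [/\ u = u', v = v' & w = w'].
Proof. by case/(@eq_col_mx _ n (n + d * n))=> -> /eq_col_mx[-> ->]. Qed.

Lemma block3_mx_mul B11 B12 B13 B21 B22 B23 B31 B32 B33 u v w :
  block3_mx B11 B12 B13 B21 B22 B23 B31 B32 B33 *m col3_mx u v w
  = col3_mx (B11 *m u + B12 *m v + B13 *m w) (B21 *m u + B22 *m v + B23 *m w)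
            (B31 *m u + B32 *m v + B33 *m w).
Proof.
rewrite /block3_mx /col3_mx.
by rewrite (@mul_col_mx _ n (n + d * n) (n + (n + d * n))) mul_col_mx
  !(@mul_row_col _ _ n (n + d * n)) !mul_row_col !addrA.
Qed.

Lemma first_unit_tens (b : 'cV[K[i]]_n) :
  first_unit K d *t b = col3_mx b 0 0.
Proof.
(* The unit vector is cut along the same blocks as [ext_basis]. *)
have -> : first_unit K d = col_mx (1%:M : 'cV_1) (col_mx (0%:M : 'cV_1) 0).
  apply/matrixP=> i j; rewrite !mxE [j]ord1 eqxx andbT.
  case: splitP=> k /= hk; rewrite -val_eqE /= hk.
    by rewrite [k]ord1 mxE.
  by rewrite mxE; case: splitP=> l _; rewrite !mxE ?mul0rn.
by rewrite !tens_col_scalar scale1r scale0r tens0mx.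
Qed.

End Blocks.

Section Pencil.

Variables (K : realType) (n m d : nat).
Variables (A0 A1 A2 : 'M[K[i]]_n) (Am : 'I_m -> 'M[K[i]]_n).
Variables (alpha : 'I_m -> K[i]) (a : 'I_m -> 'cV[K[i]]_d).
Variables (c0 c1 : 'cV[K[i]]_d) (C0 C1 : 'M[K[i]]_d).

(** The comparison is blockwise; only in the last block row does [s] sit inside a Kronecker product,
    and linearity in the left factor extracts it. *)
Lemma pencil_split (s : K[i]) :
  pencil_A A0 Am alpha a c0 C0 - s *: pencil_E A1 A2 c1 C1
  = pencil A0 A1 A2 Am alpha a c0 c1 C0 C1 s.
Proof.
rewrite /pencil_A /pencil_E /pencil /block3_mx kron_colDZ tensmxDl tensmxZl.
rewrite !(scale_col_mx, scale_row_mx, opp_col_mx, opp_row_mx, add_col_mx, add_row_mx).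
by rewrite !scalerN !opprK !scaler0 !subr0 !add0r scalemx1.
Qed.

Lemma ext_basis_tens (s : K[i]) (x : 'cV[K[i]]_n) :
  ext_basis c0 c1 C0 C1 s *t x
  = col3_mx x (s *: x) (basis_fun c0 c1 C0 C1 s *t x).
Proof. by rewrite /ext_basis !tens_col_scalar scale1r. Qed.

Lemma pencil_mul_ext_basis (s : K[i]) (x : 'cV[K[i]]_n) : C0 + s *: C1 \in unitmx ->
  pencil A0 A1 A2 Am alpha a c0 c1 C0 C1 s *m (ext_basis c0 c1 C0 C1 s *t x)
  = col3_mx (rat_mx A0 A1 A2 Am alpha a c0 c1 C0 C1 s *m x) 0 0.
Proof.
move=> uC; rewrite ext_basis_tens block3_mx_mul; congr col3_mx.
- rewrite mulmx_suml.
  under eq_bigr do rewrite kron_row_mul.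
  rewrite /rat_mx /A0_tilde !mulmxDl -!scalemxAl -scalemxAr scalerA -expr2.
  (* Each r_j(s) splits in two: the alpha_j part matches the sum in [A0_tilde], the a_j^T Phi(s)
     part the upper right block. *)
  under [X in _ = _ + X *m _]eq_bigr do rewrite /rat_coef scalerDl.
  rewrite big_split /= mulmxDl !mulmx_suml.
  under [X in _ = _ + (_ + X)]eq_bigr do rewrite -scalemxAl.
  rewrite addrA; congr (_ + _).
  by rewrite -!addrA; congr (_ + _); rewrite addrC addrA.
- by rewrite mul_scalar_mx mulNmx mul1mx mul0mx addr0 subrr.
(* Phi(s) solves (C0 + s C1) Phi = -(c0 + s c1), so the two terms cancel. *)
- rewrite kron_col_mul mul1mx mul0mx addr0 tensmx_mul_col mul1mx /basis_fun.
  by rewrite mulmxN mulKVmx // tensmxNl subrr.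
Qed.

Lemma pencil_solution (s : K[i]) (b : 'cV[K[i]]_n) (xx : 'cV[K[i]]_(d.+2 * n)) :
  C0 + s *: C1 \in unitmx ->
  pencil A0 A1 A2 Am alpha a c0 c1 C0 C1 s *m xx = first_unit K d *t b ->
  exists u : 'cV_n, xx = ext_basis c0 c1 C0 C1 s *t u.
Proof.
move=> uC; case: (col3_mxP xx)=> u [v [w ->]].
rewrite first_unit_tens block3_mx_mul => /col3_mx_inj[_ e2 e3]; exists u.
rewrite ext_basis_tens; congr col3_mx.
- move: e2; rewrite mul_scalar_mx mulNmx mul1mx mul0mx addr0 => /eqP.
  by rewrite subr_eq0 => /eqP.
- move: e3; rewrite kron_col_mul mul1mx mul0mx addr0 => /eqP.
  rewrite addrC addr_eq0 => /eqP e3.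
  (* The Kronecker product of (C0 + s C1)^-1 with I inverts the lower right block, so the third
     block equation can be solved for [w]. *)
  have -> : w = (invmx (C0 + s *: C1) *t 1%:M) *m (((C0 + s *: C1) *t 1%:M) *m w).
    by rewrite mulmxA tensmx_mul mulVmx // mulmx1 tens_mx11 mul1mx.
  rewrite e3 mulmxN tensmx_mul_col mul1mx.
  exact: esym (tensmxNl (invmx (C0 + s *: C1) *m (c0 + s *: c1)) u).
Qed.

End Pencil.

Theorem theorem2 (K : realType) (n m d : nat)
    (A0 A1 A2 : 'M[K[i]]_n) (Am : 'I_m -> 'M[K[i]]_n)
    (alpha : 'I_m -> K[i]) (a : 'I_m -> 'cV[K[i]]_d)
    (c0 c1 : 'cV[K[i]]_d) (C0 C1 : 'M[K[i]]_d) (b : 'cV[K[i]]_n)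
    (hC1 : C1 \in unitmx) :
  let R := rat_mx A0 A1 A2 Am alpha a c0 c1 C0 C1 in
  let Phi := ext_basis c0 c1 C0 C1 in
  let A := pencil_A A0 Am alpha a c0 C0 in
  let E := pencil_E A1 A2 c1 C1 in
  (forall s : K[i],
     A - s *: E = pencil A0 A1 A2 Am alpha a c0 c1 C0 C1 s) /\
  (forall s : K[i], C0 + s *: C1 \in unitmx ->
     (forall x : 'cV[K[i]]_n,
        R s *m x = b <->
        (A - s *: E) *m (Phi s *t x) = first_unit K d *t b) /\
     (forall xx : 'cV[K[i]]_(d.+2 * n),
        (A - s *: E) *m xx = first_unit K d *t b ->
        exists! x : 'cV[K[i]]_n, xx = Phi s *t x /\ R s *m x = b)).
Proof.
move=> R Phi A E; split=> [s|s uC]; first exact: pencil_split.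
have AE : A - s *: E = pencil A0 A1 A2 Am alpha a c0 c1 C0 C1 s.
  exact: pencil_split.
have equiv x : R s *m x = b <->
    (A - s *: E) *m (Phi s *t x) = first_unit K d *t b.
  (* Both sides vanish below the first block, where the equation is R(s) x = b. *)
  rewrite AE pencil_mul_ext_basis // first_unit_tens.
  by split=> [-> //|/col3_mx_inj[]].
split=> // xx sol.
have [u xxE] : exists u : 'cV_n, xx = Phi s *t u.
  by move: (sol); rewrite AE; exact: pencil_solution.
exists u; split; first by split=> //; apply/equiv; rewrite -xxE.
(* Uniqueness: the first entry of [Phi s] is 1, so x is the first block of [xx]. *)
by move=> x' [+ _]; rewrite xxE /Phi !ext_basis_tens => /col3_mx_inj[].
Qed.
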